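(* Let $\Delta$ be the clique complex of a chordal graph on $N$ vertices, with at least two maximal cliques $S_1,\ldots,S_e$ in a fixed leaf order, facet cardinalities $n_m=|S_m|$, separator cardinalities $r_1,\ldots,r_{e-1}$, and $r_{\min}=\min_m r_m$. The nonzero graded Betti numbers of $\mathbb K[\Delta^\vee]$ are $\beta_{0,0}=1$ and $$\beta_{1,j}=\bigl|\{m:N-n_m=j\}\bigr|,\qquad\beta_{2,j}=\bigl|\{m:N-r_m=j\}\bigr|.$$ In particular, $$\operatorname{reg}\mathbb K[\Delta^\vee]=N-r_{\min}-2,\qquad\operatorname{type}\mathbb K[\Delta^\vee]=e-1,\qquad a(\mathbb K[\Delta^\vee])=-r_{\min}.$$
   Context: $\mathbb K$ is a field. For a finite set $X$ with $|X|=N$, put $R=\mathbb K[x:x\in X]$ with the standard grading. A simplicial complex $\Sigma$ on $X$ is a collection of subsets (faces) of $X$ closed under inclusion; elements of $X$ not lying in any face (ghost vertices) are allowed. The Alexander dual on $X$ is $\Sigma^\vee=\{F\subseteq X:X\setminus F\notin\Sigma\}$. $I_\Sigma\subseteq R$ is generated by the monomials $\prod_{x\in A}x$ with $A\subseteq X$, $A\notin\Sigma$; $\mathbb K[\Sigma]=R/I_\Sigma$. Graded Betti numbers $\beta_{i,j}$ and regularity $\operatorname{reg}M=\max\{j-i:\beta_{i,j}(M)\ne0\}$ are over $R$. The ring $\mathbb K[\Delta^\vee]$ is Cohen–Macaulay of dimension $N-2$; its type is the rank of the last free module of its minimal free resolution, and its $a$-invariant is minus the least degree of a nonzero element of its graded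 canonical module (equivalently $\operatorname{reg}-\dim$). Chordal clique complexes: let $\Delta$ be the complex of cliques of a finite chordal graph with vertex set $X$, $|X|=N$, having $e\ge2$ maximal cliques. A leaf order of its facets (maximal cliques) is an ordering $S_1,\ldots,S_e$ such that for each $m\ge2$ there is $p(m)<m$ satisfying $S_m\cap S_i\subseteq S_m\cap S_{p(m)}$ for all $i<m$; such an order exists. For $1\le m\le e-1$ the separators are $Q_m=(S_1\cup\cdots\cup S_m)\cap S_{m+1}=S_{p(m+1)}\cap S_{m+1}$ (possibly empty), and $r_m=|Q_m|$. *)

(* Defs.v *)
From HB Require Import structures.
From mathcomp Require Import all_boot all_order all_algebra.
From mathcomp Require Import mpoly.
Set Implicit Arguments.
Unset Strict Implicit.
Unset Printing Implicit Defensive.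
Import Order.TTheory GRing.Theory Num.Theory.
Local Open Scope ring_scope.

Section Combinatorics.
Variable T : finType.

(* Every cycle of length at least 4 has a chord: an edge joining two vertices
   that are not consecutive on the cycle. *)
Definition chordal (e : rel T) : Prop :=
  forall c : seq T, (4 <= size c)%N -> ucycle e c ->
    exists x y, [/\ x \in c, y \in c, e x y, y != next c x & x != next c y].

Definition clique (e : rel T) (A : {set T}) : bool :=
  [forall x in A, forall y in A, (x != y) ==> e x y].

(* A simplicial complex is given by its set of faces; vertices of T lying in no
   face are allowed. *)
Definition clique_complex (e : rel T) : {set {set T}} := [set A | clique e A].

Definition facets (Sigma : {set {set T}}) : {set {set T}} :=
  [set A | maxset [pred B | B \in Sigma] A].

Definition alexander_dual (Sigma : {set {set T}}) : {set {set T}} :=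
  [set A | ~: A \notin Sigma].

(* The facets are numbered from 0, so nth set0 S m is the (m+1)-st one. *)
Definition leaf_order (Sigma : {set {set T}}) (S : seq {set T}) : Prop :=
  [/\ uniq S, S =i facets Sigma &
   forall m, (0 < m < size S)%N ->
     exists2 p, (p < m)%N & forall i, (i < m)%N ->
       nth set0 S m :&: nth set0 S i \subset nth set0 S m :&: nth set0 S p].

(* With facets numbered from 0, separators are indexed by m < e - 1. *)
Definition separator (S : seq {set T}) (m : nat) : {set T} :=
  (\bigcup_(i < m.+1) nth set0 S i) :&: nth set0 S m.+1.

(* The default value #|T| bounds every separator size, so for e >= 2 this is
   the minimum of the separator sizes. *)
Definition rmin (S : seq {set T}) : nat :=
  \big[minn/#|T|]_(m < (size S).-1) #|separator S m|.

End Combinatorics.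

Section StanleyReisner.
Variables (K : fieldType) (T : finType).

(* The variable attached to x : T is 'X_(enum_rank x). *)
Definition setmon (A : {set T}) : {mpoly K[#|T|]} :=
  \prod_(x in A) 'X_(enum_rank x).

Definition sr_ideal (Sigma : {set {set T}}) (p : {mpoly K[#|T|]}) : Prop :=
  exists c : {set T} -> {mpoly K[#|T|]},
    p = \sum_(A : {set T} | A \notin Sigma) c A * setmon A.

(* Krull dimension of the Stanley-Reisner ring of Sigma, i.e. one more than
   the dimension of Sigma. *)
Definition sr_dim (Sigma : {set {set T}}) : nat := \max_(A in Sigma) #|A|.

End StanleyReisner.

Section Resolutions.
Variables (K : fieldType) (n : nat).
Local Notation R := {mpoly K[n]}.

Definition zhomog (z : int) (p : R) : bool :=
  if z is Posz d then p \is d.-homog else p == 0.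

(* F_i is the sum over k of R(- gdeg i k), its elements are row vectors, and
   the differential F_(i+1) -> F_i is v |-> v *m diff i. The augmentation
   F_0 -> R/I is induced by v |-> v *m aug. *)
Record graded_complex := GradedComplex {
  grank : nat -> nat;
  gdeg : forall i, 'I_(grank i) -> int;
  diff : forall i, 'M[R]_(grank i.+1, grank i);
  aug : 'cV[R]_(grank 0)
}.

Definition graded_maps (F : graded_complex) : Prop :=
  (forall k, zhomog (gdeg k) (aug F k 0)) /\
  (forall i k l, zhomog (gdeg k - gdeg l) (diff F i k l)).

Definition free_resolution (I : R -> Prop) (F : graded_complex) : Prop :=
  [/\ graded_maps F,
      exists v : 'rV_(grank F 0), I ((v *m aug F) 0 0 - 1),
      forall v : 'rV_(grank F 0),
        I ((v *m aug F) 0 0) <-> exists w, v = w *m diff F 0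
    & forall i (v : 'rV_(grank F i.+1)),
        v *m diff F i = 0 <-> exists w, v = w *m diff F i.+1].

(* Minimality: the differentials are zero modulo the ideal of the variables. *)
Definition minimal_resolution (I : R -> Prop) (F : graded_complex) : Prop :=
  free_resolution I F /\ forall i k l, (diff F i k l)@_0%MM = 0.

(* The remaining definitions are meant for a minimal resolution F of R/I. *)
Definition betti (F : graded_complex) (i : nat) (j : int) : nat :=
  #|[set k : 'I_(grank F i) | gdeg k == j]|.

Definition is_reg (F : graded_complex) (r : int) : Prop :=
  (exists i j, betti F i j <> 0%N /\ j - i%:Z = r) /\
  (forall i j, betti F i j <> 0%N -> j - i%:Z <= r).

Definition is_type (F : graded_complex) (t : nat) : Prop :=
  exists p, [/\ grank F p <> 0%N, forall q, (p < q)%N -> grank F q = 0%N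
              & t = grank F p].

(* Elements of Hom(F_c, R(-n)) are column vectors: u maps the k-th basis
   vector, of degree gdeg k, to u k 0. *)
Definition cocycle (F : graded_complex) c (u : 'cV[R]_(grank F c)) : Prop :=
  diff F c *m u = 0.

Definition coboundary (F : graded_complex) c : 'cV[R]_(grank F c) -> Prop :=
  match c with
  | 0 => fun u => u = 0
  | c'.+1 => fun u => exists w, u = diff F c' *m w
  end.

(* Ext^c(R/I, R(-n)) has a nonzero element of degree t; an element of R(-n) of
   degree t is a polynomial of degree t - n. *)
Definition ext_nonzero (F : graded_complex) (c : nat) (t : int) : Prop :=
  exists u : 'cV[R]_(grank F c),
    [/\ forall k, zhomog (t + gdeg k - n%:Z) (u k 0),
        cocycle u & ~ coboundary u].

(* For R/I Cohen-Macaulay of dimension d, the graded canonical module is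
   Ext^(n-d)(R/I, R(-n)). *)
Definition is_a_invariant (F : graded_complex) (d : nat) (a : int) : Prop :=
  ext_nonzero F (n - d) (- a) /\
  (forall t, ext_nonzero F (n - d) t -> - a <= t).

End Resolutions.

(* Main.v *)
Require Import Defs.
From HB Require Import structures.
From mathcomp Require Import all_boot all_order all_algebra.
From mathcomp Require Import mpoly.
From mathcomp Require Import zify ring.
Set Implicit Arguments.
Unset Strict Implicit.
Unset Printing Implicit Defensive.
Import Order.TTheory GRing.Theory Num.Theory.
Local Open Scope ring_scope.

(** The ideal of the Alexander dual is generated by the monomials
    [f_m = setmon (~: S_m)] of the complements of the facets, and the leaf order
    makes its successive colon ideals principal: the colon ideal of
    [(f_0, ..., f_(m-1))] by [f_m] is generated by the monomials of
    [S_m :\: S_i] for [i < m], and the leaf condition says that the one for the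
    parent [S_p] of [S_m] divides all the others.  So each facet after the first
    contributes exactly one relation, the two-term relation between [f_m] and
    [f_p], of degree [N - |S_m :&: S_p|], where [S_m :&: S_p] is a separator.
    The relations are triangular with respect to the order of the facets, hence
    independent.  This yields an explicit free resolution of length two
    ([leaf_relations_generate], [leaf_relations_free]), which is minimal because
    facets are pairwise incomparable ([leaf_resolution_minimal]).

    The Betti numbers of an arbitrary minimal resolution are those of the
    explicit one by the comparison theorem: graded chain maps in both directions
    lift the identity of the quotient ring, their composite is homotopic to the
    identity, and minimality turns the homotopy into zero modulo the variables
    ([minimal_constant_maps]).  The constant parts of the chain maps are thus
    inverse matrices that respect degrees, which bounds the ranks degree by
    degree ([minimal_betti_le]).

    The three invariants are then read off.  Every facet strictly contains some
    separator, so the last module determines the regularity.  Two non-adjacent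
    vertices form a smallest non-clique, hence the dimension is [N - 2] and the
    canonical module is the second [Ext], the cokernel of the dual of the last
    map; by minimality its lowest degree is attained on the dual basis vector of
    a generator of largest degree. *)

(** * Homogeneous components *)

Definition hcomp {K : fieldType} {n : nat} (z : int) (p : {mpoly K[n]}) :
    {mpoly K[n]} :=
  if z is Posz d then pihomog mdeg d p else 0.

Lemma zhomog0 (K : fieldType) (n : nat) (z : int) :
  zhomog z (0 : {mpoly K[n]}).
Proof. by case: z => [d|d] /=; rewrite ?eqxx ?dhomog0. Qed.

Lemma zhomogD (K : fieldType) (n : nat) (z : int) (p q : {mpoly K[n]}) :
  zhomog z p -> zhomog z q -> zhomog z (p + q).
Proof.
case: z => [d|d] /=; first exact: dhomogD.
by move=> /eqP-> /eqP->; rewrite addr0.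
Qed.

Lemma zhomogN (K : fieldType) (n : nat) (z : int) (p : {mpoly K[n]}) :
  zhomog z p -> zhomog z (- p).
Proof. by case: z => [d|d] /=; rewrite ?dhomogN ?oppr_eq0. Qed.

Lemma zhomogM (K : fieldType) (n : nat) (y z : int) (p q : {mpoly K[n]}) :
  zhomog y p -> zhomog z q -> zhomog (y + z) (p * q).
Proof.
case: y => [d|d] /=; last by move/eqP-> => _; rewrite mul0r zhomog0.
case: z => [e|e] /=; last by move=> _ /eqP->; rewrite mulr0 zhomog0.
exact: dhomogM.
Qed.

Lemma zhomog_sum (K : fieldType) (n : nat) (z : int) (J : Type) (r : seq J)
    (P : pred J) (E : J -> {mpoly K[n]}) :
  (forall j, P j -> zhomog z (E j)) -> zhomog z (\sum_(j <- r | P j) E j).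
Proof.
move=> hE; elim/big_rec: _ => [|j p Pj]; first exact: zhomog0.
exact/zhomogD/hE.
Qed.

Lemma zhomog_const (K : fieldType) (n : nat) (z : int) (p : {mpoly K[n]}) :
  zhomog z p -> p@_0%MM != 0 -> z = 0.
Proof.
case: z => [d|d] /=; last by move=> /eqP->; rewrite mcoeff0 eqxx.
move=> hp; case: (eqVneq d 0%N) => [->//|d0]; apply: contraNeq => _.
by rewrite (dhomog_nemf_coeff hp) //= mf0 eq_sym.
Qed.

Lemma zhomog_ge0 (K : fieldType) (n : nat) (z : int) (p : {mpoly K[n]}) :
  zhomog z p -> p != 0 -> 0 <= z.
Proof. by case: z => //= d ->. Qed.

Lemma hcomp_zhomog (K : fieldType) (n : nat) (z : int) (p : {mpoly K[n]}) :
  zhomog z (hcomp z p).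
Proof. by case: z => [d|d] /=; rewrite ?pihomogP. Qed.

Lemma hcomp_sum (K : fieldType) (n : nat) (z : int) (J : Type) (r : seq J)
    (P : pred J) (E : J -> {mpoly K[n]}) :
  hcomp z (\sum_(j <- r | P j) E j) = \sum_(j <- r | P j) hcomp z (E j).
Proof. by case: z => [d|d] /=; rewrite ?linear_sum //= big1. Qed.

Lemma hcompB (K : fieldType) (n : nat) (z : int) (p q : {mpoly K[n]}) :
  hcomp z (p - q) = hcomp z p - hcomp z q.
Proof. by case: z => [d|d] /=; rewrite ?linearB ?subr0. Qed.

Lemma hcompZ (K : fieldType) (n : nat) (z : int) (c : K) (p : {mpoly K[n]}) :
  hcomp z (c *: p) = c *: hcomp z p.
Proof. by case: z => [d|d] /=; rewrite ?linearZ //= scaler0. Qed.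

Lemma hcomp_id (K : fieldType) (n : nat) (y z : int) (p : {mpoly K[n]}) :
  zhomog y p -> hcomp z p = if z == y then p else 0.
Proof.
case: y => [d|d] /=; last first.
  by move/eqP->; case: z => [e|e] /=; rewrite ?pihomog0 ?if_same.
move=> hp; case: z => [e|e] //=; rewrite eqz_nat.
by case: (eqVneq d e) => [<-|ne]; [rewrite pihomog_dE | rewrite (pihomog_ne0 ne hp)].
Qed.

(** Expanding [p] into monomials reduces this to the fact that a homogeneous
    polynomial is its own only component; negative degrees need no separate
    treatment. *)
Lemma hcompM (K : fieldType) (n : nat) (y z : int) (p q : {mpoly K[n]}) :
  zhomog y q -> hcomp (z + y) (p * q) = hcomp z p * q.
Proof.
move=> hq; rewrite (mpolyE p) mulr_suml !hcomp_sum mulr_suml.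
apply: eq_bigr => m _; rewrite -scalerAl !hcompZ -scalerAl; congr (_ *: _).
have hm : zhomog (mdeg m)%:Z 'X_[K, m] by rewrite /= dhomogX.
rewrite (hcomp_id _ hm) (hcomp_id _ (zhomogM hm hq)).
rewrite (inj_eq (addIr y)).
by case: ifP; rewrite ?mul0r.
Qed.

(** * Comparison of graded free resolutions *)

Definition graded_mx {K : fieldType} {n p q : nat} (a : 'I_p -> int)
    (b : 'I_q -> int) (M : 'M[{mpoly K[n]}]_(p, q)) : Prop :=
  forall k l, zhomog (a k - b l) (M k l).

Definition homogeneous_ideal {K : fieldType} {n : nat}
    (I : {mpoly K[n]} -> Prop) : Prop :=
  [/\ I 0, forall p q, I p -> I q -> I (p + q),
      forall p q, I q -> I (p * q) & forall z p, I p -> I (hcomp z p)].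

Lemma graded_mulmx (K : fieldType) (n p q r : nat) (a : 'I_p -> int)
    (b : 'I_q -> int) (c : 'I_r -> int) (M : 'M[{mpoly K[n]}]_(p, q)) N :
  graded_mx a b M -> graded_mx b c N -> graded_mx a c (M *m N).
Proof.
move=> hM hN k l; rewrite mxE; apply: zhomog_sum => j _.
have -> : a k - c l = (a k - b j) + (b j - c l) by ring.
exact: zhomogM.
Qed.

(** A solution of a graded linear system can be replaced by its component of
    the right degree. *)
Lemma graded_lift (K : fieldType) (n p q r : nat) (a : 'I_p -> int)
    (b : 'I_q -> int) (c : 'I_r -> int)
    (M : 'M[{mpoly K[n]}]_(p, q)) (D : 'M_(r, q)) :
  graded_mx a b M -> graded_mx c b D ->
  (forall k, exists w : 'rV_r, row k M = w *m D) ->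
  exists2 W, graded_mx a c W & M = W *m D.
Proof.
move=> hM hD /fin_all_exists[w hw].
exists (\matrix_(k, j) hcomp (a k - c j) (w k 0 j)).
  by move=> k j; rewrite mxE hcomp_zhomog.
apply/matrixP=> k l; rewrite mxE.
under eq_bigr => j _ do rewrite mxE -(hcompM _ _ (hD j l)) subrKA.
rewrite -hcomp_sum.
have := congr1 (fun v : 'rV_q => v 0 l) (hw k); rewrite !mxE => <-.
by rewrite (hcomp_id _ (hM k l)) eqxx.
Qed.

Lemma ideal_mulmx (K : fieldType) (n p q : nat) (I : {mpoly K[n]} -> Prop)
    (M : 'M_(p, q)) (C : 'cV_q) :
  homogeneous_ideal I -> (forall k, I (C k 0)) -> forall k, I ((M *m C) k 0).
Proof.
move=> [I0 ID IM _] hC k; rewrite mxE; elim/big_ind: _ => // j _; exact: IM.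
Qed.

(** The extension is recorded with the map because it serves as the map of the
    next stage; this avoids constructing an infinite sequence of maps at once. *)
Definition chain_step {K : fieldType} {n : nat} (F G : graded_complex K n) i
    (f : 'M_(grank F i, grank G i)) : Prop :=
  graded_mx (@gdeg K n F i) (@gdeg K n G i) f /\
  exists2 f', graded_mx (@gdeg K n F i.+1) (@gdeg K n G i.+1) f'
    & diff F i *m f = f' *m diff G i.

(** The last condition is what is needed to continue the homotopy [h] in the
    next degree. *)
Definition comparison {K : fieldType} {n : nat} (F G : graded_complex K n) i
    (phi : 'M_(grank F i, grank G i)) (psi : 'M_(grank G i, grank F i)) : Prop :=
  [/\ chain_step phi, chain_step psi,
      forall k l, ((phi *m psi - 1%:M) k l)@_0%MM = 0
    & exists h, diff F i *m (phi *m psi - 1%:M - h *m diff F i) = 0].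

Lemma mulmx_const0 (K : fieldType) (n p q r : nat)
    (M : 'M[{mpoly K[n]}]_(p, q)) (N : 'M_(q, r)) :
  (forall k l, (M k l)@_0%MM = 0) \/ (forall k l, (N k l)@_0%MM = 0) ->
  forall k l, ((M *m N) k l)@_0%MM = 0.
Proof.
move=> h k l; rewrite mxE raddf_sum big1 //= => j _; rewrite rmorphM /=.
by case: h => ->; rewrite ?mul0r ?mulr0.
Qed.

Lemma diff_diff {K : fieldType} {n : nat} {I : {mpoly K[n]} -> Prop} {F} i :
  free_resolution I F -> diff F i.+1 *m diff F i = 0.
Proof.
case=> _ _ _ ex; apply/row_matrixP=> k; rewrite row_mul row0.
by apply/ex; exists (delta_mx 0 k); rewrite rowE.
Qed.

(** The augmentation of [G] hits 1 modulo [I], so a basis vector of [F] can be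
    sent to a multiple of a preimage of 1, cut down to the right degree. *)
Lemma augmentation_lift {K : fieldType} {n : nat} {I : {mpoly K[n]} -> Prop}
    {F G} :
  homogeneous_ideal I -> graded_maps F -> free_resolution I G ->
  exists2 phi, graded_mx (@gdeg K n F 0) (@gdeg K n G 0) phi
    & forall k, I ((phi *m aug G - aug F) k 0).
Proof.
move=> [I0 ID IM Ih] [augF _] [[augG _] [v hv] _ _].
exists (\matrix_(k, l) hcomp (gdeg k - gdeg l) (aug F k 0 * v 0 l)).
  by move=> k l; rewrite mxE hcomp_zhomog.
move=> k; rewrite !mxE.
under eq_bigr => j _ do rewrite mxE -(hcompM _ _ (augG j)) subrK -mulrA.
rewrite -hcomp_sum -mulr_sumr.
move: hv => /(IM (aug F k 0)) /(Ih (gdeg k)).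
rewrite mulrBr mulr1 mxE; set s := \sum_j _.
by rewrite hcompB (hcomp_id _ (augF k)) eqxx.
Qed.

Lemma comparison0 {K : fieldType} {n : nat} {I : {mpoly K[n]} -> Prop} {F G} :
  homogeneous_ideal I -> minimal_resolution I F -> free_resolution I G ->
  exists phi psi, @comparison K n F G 0 phi psi.
Proof.
move=> hI [hF minF] hG; have [gF _ eF _] := hF; have [gG _ eG _] := hG.
have lift (A B : graded_complex K n) phi : free_resolution I A ->
    free_resolution I B -> graded_mx (@gdeg K n A 0) (@gdeg K n B 0) phi ->
    (forall k, I ((phi *m aug B - aug A) k 0)) ->
    chain_step phi.
  move=> [[_ gA] _ eA _] [[_ gB] _ eB _] gphi Iphi; split=> //.
  apply: graded_lift (graded_mulmx (gA 0%N) gphi) (gB 0%N) _ => k.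
  apply/eB; rewrite row_mul -mulmxA.
  have [I0 ID IM _] := hI.
  have -> : phi *m aug B = (phi *m aug B - aug A) + aug A by rewrite subrK.
  rewrite mulmxDr mxE; apply: ID; first exact: ideal_mulmx.
  by apply/eA; exists (delta_mx 0 k); rewrite rowE.
have [phi gphi Iphi] := augmentation_lift hI gF hG.
have [psi gpsi Ipsi] := augmentation_lift hI gG hF.
have : forall k, exists w, row k (phi *m psi - 1%:M) = w *m diff F 0.
  move=> k; apply/eF; have [I0 ID IM _] := hI.
  rewrite -row_mul mxE mulmxBl mul1mx -mulmxA.
  have -> : phi *m (psi *m aug F) - aug F =
      phi *m (psi *m aug F - aug G) + (phi *m aug G - aug F).
    by rewrite mulmxBr addrA subrK.
  by rewrite mxE; apply: ID => //; apply: ideal_mulmx.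
case/fin_all_exists=> h hh.
have e : phi *m psi - 1%:M = (\matrix_k h k) *m diff F 0.
  by apply/row_matrixP=> k; rewrite hh row_mul rowK.
exists phi, psi; split=> //; [exact: (lift F G)|exact: (lift G F)| |].
  by rewrite e; apply: mulmx_const0; right.
by exists (\matrix_k h k); rewrite e subrr mulmx0.
Qed.

(** The usual construction of chain maps and homotopies, one degree at a time.
    The identity is reached modulo the variables because the two homotopy terms
    have a differential of [F] as a factor. *)
Lemma comparisonS {K : fieldType} {n : nat} {I : {mpoly K[n]} -> Prop} {F G} i :
  minimal_resolution I F -> free_resolution I G ->
  (exists phi psi, @comparison K n F G i phi psi) ->
  exists phi psi, @comparison K n F G i.+1 phi psi.
Proof.
move=> [hF minF] hG [phi0 [psi0 [[_ [phi gphi Dphi]] [_ [psi gpsi Dpsi]] _ [h Dh]]]].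
have [[_ gF] _ _ eF] := hF; have [[_ gG] _ _ eG] := hG.
have lift (A B : graded_complex K n) (f0 : 'M_(grank A i, grank B i)) f :
    free_resolution I A -> free_resolution I B -> graded_mx (@gdeg K n A i.+1) (@gdeg K n B i.+1) f ->
    diff A i *m f0 = f *m diff B i ->
    chain_step f.
  move=> hA [[_ gB] _ _ eB] gf Df; have [[_ gA] _ _ _] := hA; split=> //.
  apply: graded_lift (graded_mulmx (gA i.+1) gf) (gB i.+1) _ => k.
  apply/eB; rewrite -row_mul -mulmxA -Df mulmxA (diff_diff i hA).
  by rewrite mul0mx row0.
have : forall k, exists w,
    row k (phi *m psi - 1%:M - diff F i *m h) = w *m diff F i.+1.
  move=> k; apply/eF; rewrite -row_mul; move: Dh.
  rewrite !mulmxBl !mulmxBr mul1mx mulmx1 -[phi *m psi *m _]mulmxA -Dpsi.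
  by rewrite !mulmxA -Dphi => ->; rewrite row0.
case/fin_all_exists=> h' hh'.
have e : phi *m psi - 1%:M = (\matrix_k h' k) *m diff F i.+1 + diff F i *m h.
  apply/eqP; rewrite -subr_eq; apply/eqP/row_matrixP=> k.
  by rewrite hh' row_mul rowK.
exists phi, psi; split=> //; [exact: (lift F G phi0)|exact: (lift G F psi0)| |].
  move=> k l; rewrite e mxE mcoeffD !mulmx_const0 ?addr0 //; [by left|by right].
by exists (\matrix_k h' k); rewrite e addrC addKr mulmxA (diff_diff i hF) mul0mx.
Qed.

(** Restricting [A] and [B] to the indices of degree [j] keeps the product equal
    to the identity, since [A] vanishes between indices of different degrees. *)
Lemma right_invertible_card (K : fieldType) (p q : nat) (a : 'I_p -> int)
    (b : 'I_q -> int) (A : 'M[K]_(p, q)) (B : 'M_(q, p)) (j : int) :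
  A *m B = 1%:M -> (forall k l, A k l != 0 -> a k = b l) ->
  (#|[set k | a k == j]| <= #|[set l | b l == j]|)%N.
Proof.
move=> AB1 hA; set X := [set k | _]; set Y := [set l | _].
pose A' := \matrix_(k < #|X|, l < #|Y|) A (enum_val k) (enum_val l).
pose B' := \matrix_(l < #|Y|, k < #|X|) B (enum_val l) (enum_val k).
apply: (@mulmx1_min _ _ _ A' B'); apply/matrixP=> k k'; rewrite !mxE.
under eq_bigr do rewrite !mxE.
rewrite -(big_enum_val (fun l => A (enum_val k) l * B l (enum_val k'))) /=.
have := congr1 (fun M : 'M_p => M (enum_val k) (enum_val k')) AB1.
rewrite !mxE (inj_eq enum_val_inj) => <-.
rewrite [RHS](bigID (mem Y)) /= [X in _ + X]big1 ?addr0 // => l lY.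
apply/eqP; rewrite mulf_eq0; apply/orP; left; apply: contraNT lY => /hA e.
by have := enum_valP k; rewrite !inE e.
Qed.

Lemma minimal_constant_maps {K : fieldType} {n : nat}
    {I : {mpoly K[n]} -> Prop} {F G} i :
  homogeneous_ideal I -> minimal_resolution I F -> free_resolution I G ->
  exists (A : 'M[K]_(grank F i, grank G i)) (B : 'M[K]_(grank G i, grank F i)),
    A *m B = 1%:M /\ forall k l, A k l != 0 -> gdeg k = gdeg l.
Proof.
move=> hI hF hG.
have [phi [psi [[gphi _] _ hc _]]] : exists phi psi, @comparison K n F G i phi psi.
  by elim: i => [|i]; [exact: (comparison0 hI hF hG)|exact: (comparisonS hF hG)].
exists (map_mx (mcoeff 0%MM) phi), (map_mx (mcoeff 0%MM) psi); split; last first.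
  by move=> k l; rewrite mxE => /(zhomog_const (gphi k l)) /subr0_eq.
rewrite -map_mxM; apply/matrixP=> k l; rewrite mxE /=.
have := hc k l; rewrite mxE [X in _ + X]mxE mcoeffB => /subr0_eq ->.
by rewrite !mxE mcoeffMn mcoeff1 eqxx.
Qed.

Lemma minimal_rank_le (K : fieldType) (n : nat) (I : {mpoly K[n]} -> Prop) F G i :
  homogeneous_ideal I -> minimal_resolution I F -> free_resolution I G ->
  (grank F i <= grank G i)%N.
Proof.
by move=> hI hF hG; have [A [B [/mulmx1_min]]] := minimal_constant_maps i hI hF hG.
Qed.

Lemma minimal_betti_le (K : fieldType) (n : nat) (I : {mpoly K[n]} -> Prop) F G i j :
  homogeneous_ideal I -> minimal_resolution I F -> free_resolution I G ->
  (betti F i j <= betti G i j)%N.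
Proof.
move=> hI hF hG; have [A [B [AB1 hA]]] := minimal_constant_maps i hI hF hG.
exact: right_invertible_card AB1 hA.
Qed.

(** * Squarefree monomials *)

Definition setmnm {T : finType} (A : {set T}) : 'X_{1..#|T|} :=
  (\sum_(x in A) U_(enum_rank x))%MM.

Lemma setmonE (K : fieldType) (T : finType) (A : {set T}) :
  setmon K A = 'X_[setmnm A].
Proof.
rewrite /setmon /setmnm; elim/big_rec2: _ => [|x m p _ ->]; first by rewrite mpolyX0.
by rewrite mpolyXD.
Qed.

Lemma setmnmE (T : finType) (A : {set T}) (x : T) :
  setmnm A (enum_rank x) = (x \in A).
Proof.
rewrite mnm_sumE; under eq_bigr do rewrite mnm1E (inj_eq enum_rank_inj).
have [xA|xA] := boolP (x \in A).
  rewrite (bigD1 x) //= eqxx big1 ?addn0 // => y /andP[_ /negbTE].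
  by move->.
by rewrite big1 // => y yA; case: eqP => // yx; rewrite -yx yA in xA.
Qed.

Lemma setmon_zhomog (K : fieldType) (T : finType) (A : {set T}) :
  zhomog #|A|%:Z (setmon K A).
Proof.
rewrite setmonE /= dhomogX /= mdeg_sum.
by under eq_bigr do rewrite mdeg1; rewrite sum1_card.
Qed.

Lemma setmon_neq0 (K : fieldType) (T : finType) (A : {set T}) : setmon K A != 0.
Proof.
apply/eqP=> /(congr1 (mcoeff (setmnm A))); rewrite setmonE mcoeffX eqxx mcoeff0.
exact/eqP/oner_neq0.
Qed.

Lemma setmon_const0 (K : fieldType) (T : finType) (A : {set T}) :
  A != set0 -> (setmon K A)@_0%MM = 0.
Proof.
move=> A0; apply/eqP; apply: contraNT A0.
by move/(zhomog_const (setmon_zhomog K A)) => [] /cards0_eq ->.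
Qed.

Lemma setmonU (K : fieldType) (T : finType) (A B : {set T}) :
  [disjoint A & B] -> setmon K (A :|: B) = setmon K A * setmon K B.
Proof.
by move=> AB; rewrite /setmon -bigU //; apply: eq_bigl => x; rewrite !inE.
Qed.

Lemma setmonD (K : fieldType) (T : finType) (A B : {set T}) :
  A \subset B -> setmon K B = setmon K (B :\: A) * setmon K A.
Proof.
move=> AB; rewrite -{1}(setID B A) (setIidPr AB) setUC setmonU //.
by rewrite disjoint_sym disjoints_subset setCD subsetUr.
Qed.

(** A monomial of [v] that is not divisible by [setmon K U] stays so after
    multiplication by [setmon K W], because [U] and [W] share no variable. *)
Lemma setmon_coprime (K : fieldType) (T : finType) (U W : {set T})
    (q v : {mpoly K[#|T|]}) :
  [disjoint U & W] -> q * setmon K U = v * setmon K W ->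
  exists c, v = c * setmon K U.
Proof.
rewrite !setmonE => UW e.
exists (\sum_(m <- msupp v) v@_m *: 'X_[m - setmnm U]).
rewrite mulr_suml {1}(mpolyE v); apply: eq_big_seq => m mv.
rewrite -scalerAl -mpolyXD submK //; apply/mnm_lepP => i.
rewrite -(enum_valK i); move: {i}(enum_val i) => x; rewrite setmnmE.
have [xU|//] := boolP (x \in U).
have xW : x \notin W by rewrite (disjointFr UW).
move: mv; rewrite mcoeff_msupp -(mcoeffMX v (setmnm W)) -e.
rewrite lt0n; apply: contraNneq => mx; apply/eqP.
apply: memN_msupp_eq0; apply/negP => /msuppM_le /allpairsP [[m1 m2]] /=.
rewrite msuppX inE => -[_ /eqP->].
move/(congr1 (fun m : 'X_{1..#|T|} => m (enum_rank x))).
by rewrite !mnmDE !setmnmE xU (negbTE xW) mx; lia.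
Qed.

Lemma sr_ideal_homogeneous (K : fieldType) (T : finType) (Sigma : {set {set T}}) :
  @homogeneous_ideal K #|T| (sr_ideal Sigma).
Proof.
split.
- by exists (fun=> 0); rewrite big1 // => A _; rewrite mul0r.
- move=> p q [c ->] [d ->]; exists (fun A => c A + d A).
  by rewrite -big_split; apply: eq_bigr => A _; rewrite mulrDl.
- move=> p q [c ->]; exists (fun A => p * c A).
  by rewrite mulr_sumr; apply: eq_bigr => A _; rewrite mulrA.
move=> z p [c ->]; exists (fun A : {set T} => hcomp (z - #|A|%:Z) (c A)).
rewrite hcomp_sum; apply: eq_bigr => A _.
by rewrite -(hcompM _ _ (setmon_zhomog K A)) subrK.
Qed.

(** * Leaf orders *)

Lemma facets_incomparable (T : finType) (Sigma : {set {set T}}) (A B : {set T}) :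
  A \in facets Sigma -> B \in facets Sigma -> A \subset B -> A = B.
Proof.
rewrite !inE => /maxsetP[_ maxA] /maxsetP[hB _] AB.
by rewrite (maxA B hB AB).
Qed.

Lemma face_in_facet (T : finType) (Sigma : {set {set T}}) (A : {set T}) :
  A \in Sigma -> exists2 B, B \in facets Sigma & A \subset B.
Proof.
move=> hA; have [B hB AB] := @maxset_exists _ [pred B | B \in Sigma] A hA.
by exists B; rewrite ?inE.
Qed.

Lemma next_ord_subproof (n : nat) (m : 'I_n.-1) : (m.+1 < n)%N.
Proof. by case: m => m /=; case: n. Qed.

Definition next_ord (n : nat) (m : 'I_n.-1) : 'I_n := Ordinal (next_ord_subproof m).

(** The leaf condition only asserts existence, while the relations below depend
    on a choice of [p]. *)
Definition leaf_parent {T : finType} (S : seq {set T})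
    (p : 'I_(size S).-1 -> 'I_(size S)) : Prop :=
  forall m, (p m < next_ord m)%N /\ forall i : 'I_(size S), (i < next_ord m)%N ->
     nth set0 S (next_ord m) :&: nth set0 S i
       \subset nth set0 S (next_ord m) :&: nth set0 S (p m).

Lemma leaf_parent_exists (T : finType) (Sigma : {set {set T}}) (S : seq {set T}) :
  leaf_order Sigma S -> exists p, @leaf_parent T S p.
Proof.
case=> _ _ hS.
suff /fin_all_exists[p hp] : forall m : 'I_(size S).-1, exists q : 'I_(size S),
    (q < next_ord m)%N /\ forall i : 'I_(size S), (i < next_ord m)%N ->
     nth set0 S (next_ord m) :&: nth set0 S i
       \subset nth set0 S (next_ord m) :&: nth set0 S q by exists p.
move=> m; have [|p pm hp] := hS (next_ord m); first by rewrite ltn_ord.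
exists (Ordinal (ltn_trans pm (ltn_ord _))); split=> // i; exact: hp.
Qed.

Lemma separatorE (T : finType) (S : seq {set T}) p (m : 'I_(size S).-1) :
  leaf_parent p ->
  separator S m = nth set0 S (next_ord m) :&: nth set0 S (p m).
Proof.
move=> /(_ m)[pm hp]; rewrite /separator setIC; apply/eqP.
rewrite eqEsubset; apply/andP; split; last first.
  by apply: setIS; apply: (bigcup_sup (Ordinal pm)).
apply/subsetP=> x /setIP[xm /bigcupP[i _ xi]].
have iS := leq_trans (ltn_ord i) (ltnW (next_ord_subproof m)).
have := hp (Ordinal iS) (ltn_ord i).
by move/subsetP; apply; rewrite inE xm.
Qed.

Lemma facet_diff_neq0 (T : finType) (Sigma : {set {set T}}) (S : seq {set T})
    (i j : 'I_(size S)) :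
  leaf_order Sigma S -> i != j -> nth set0 S i :\: nth set0 S j != set0.
Proof.
case=> uS memS _ ij; rewrite setD_eq0; apply: contraNN ij => sub.
rewrite -val_eqE -(nth_uniq set0 (ltn_ord i) (ltn_ord j) uS); apply/eqP.
by apply: (@facets_incomparable _ Sigma) sub; rewrite -memS mem_nth.
Qed.

(** * The resolution attached to a leaf order *)

Definition facet_gens (K : fieldType) {T : finType} (S : seq {set T}) :
    'cV[{mpoly K[#|T|]}]_(size S) :=
  \col_m setmon K (~: nth set0 S m).

(** Both terms of a relation bring a generator to the monomial of the complement
    of [nth set0 S (next_ord m) :&: nth set0 S (p m)], the least common
    multiple of the two. *)
Definition leaf_relations (K : fieldType) {T : finType} (S : seq {set T})
    (p : 'I_(size S).-1 -> 'I_(size S)) :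
    'M[{mpoly K[#|T|]}]_((size S).-1, size S) :=
  \matrix_(m, l)
    (setmon K (nth set0 S (next_ord m) :\: nth set0 S (p m)) *+ (l == next_ord m)
     - setmon K (nth set0 S (p m) :\: nth set0 S (next_ord m)) *+ (l == p m)).

Definition leaf_rank {T : finType} (S : seq {set T}) (i : nat) : nat :=
  match i with 0 => 1 | 1 => size S | 2 => (size S).-1 | _ => 0 end.

Definition leaf_resolution (K : fieldType) {T : finType} (S : seq {set T})
    (p : 'I_(size S).-1 -> 'I_(size S)) : graded_complex K #|T| :=
  @GradedComplex K #|T| (leaf_rank S)
    (fun i => match i return 'I_(leaf_rank S i) -> int with
      | 1 => fun m => #|T|%:Z - #|nth set0 S m|%:Z
      | 2 => fun m => #|T|%:Z - #|separator S m|%:Z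
      | _ => fun=> 0 end)
    (fun i => match i return 'M_(leaf_rank S i.+1, leaf_rank S i) with
      | 0 => facet_gens K S
      | 1 => leaf_relations K p
      | _ => 0 end)
    (const_mx 1).

Lemma mul_facet_gens (K : fieldType) (T : finType) (S : seq {set T})
    (v : 'rV_(size S)) :
  (v *m facet_gens K S) 0 0 = \sum_m v 0 m * setmon K (~: nth set0 S m).
Proof. by rewrite mxE; apply: eq_bigr => m _; rewrite mxE. Qed.

Lemma sum_delta (R : nzRingType) (n : nat) (a : R) (L : 'I_n) (f : 'I_n -> R) :
  \sum_l (a *+ (l == L)) * f l = a * f L.
Proof.
rewrite (bigD1 L) //= eqxx big1 ?addr0 // => l /negbTE->.
by rewrite mulr0n mul0r.
Qed.

Lemma leaf_relations_gens (K : fieldType) (T : finType) (S : seq {set T}) p :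
  leaf_relations K p *m facet_gens K S = 0.
Proof.
apply/matrixP=> m j; rewrite ord1 !mxE.
under eq_bigr do rewrite !mxE mulrBl.
rewrite sumrB !sum_delta.
set A := nth set0 S _; set B := nth set0 S _.
have e (C D : {set T}) :
    setmon K (C :\: D) * setmon K (~: C) = setmon K (~: (C :&: D)).
  rewrite -setmonU; first by rewrite setDE setUIl setUCr setTI setUC setCI.
  by rewrite disjoints_subset setCK subsetDl.
by rewrite !e [B :&: A]setIC subrr.
Qed.

(** Since [S_k] meets every earlier facet inside its parent, the monomial of
    [S_k :\: S_(parent k)] divides every earlier generator, and it shares no
    variable with the [k]-th one; hence it divides the leading coefficient of
    the syzygy [v]. *)
Lemma leading_coefficient (K : fieldType) (T : finType) (S : seq {set T}) p
    (m : 'I_(size S).-1) (v : 'rV_(size S)) :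
  leaf_parent p -> (forall l : 'I_(size S), (next_ord m < l)%N -> v 0 l = 0) ->
  v *m facet_gens K S = 0 ->
  exists c, v 0 (next_ord m) =
    c * setmon K (nth set0 S (next_ord m) :\: nth set0 S (p m)).
Proof.
move=> /(_ m)[_ hp] hv /(congr1 (fun M : 'M_1 => M 0 0)).
rewrite mul_facet_gens mxE (bigD1 (next_ord m)) //= => /eqP.
set U := _ :\: _; rewrite addr_eq0 => /eqP e.
have : exists q, - (\sum_(i < size S | i != next_ord m)
    v 0 i * setmon K (~: nth set0 S i)) = q * setmon K U.
  exists (- \sum_(i < size S | i != next_ord m)
    v 0 i * setmon K (~: nth set0 S i :\: U)).
  rewrite mulNr mulr_suml; congr (- _); apply: eq_bigr => i im.
  case: (ltngtP i (next_ord m)) => [lt|gt|/val_inj eq_im].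
  - rewrite -mulrA -setmonD //; apply/subsetP => x; rewrite !inE => /andP[xp xm].
    apply: contraNN xp => xi; move/subsetP: (hp i lt) => /(_ x).
    by rewrite !inE xm xi; apply.
  - by rewrite hv // !mul0r.
  - by rewrite eq_im eqxx in im.
move=> [q eq]; apply: (@setmon_coprime _ _ _ (~: nth set0 S (next_ord m)) q).
  by rewrite disjoints_subset setCK subsetDl.
by rewrite e.
Qed.

(** Induction on the last facet in the support of the syzygy: subtracting a
    multiple of its relation clears its coefficient and only changes earlier
    ones. *)
Lemma leaf_relations_generate (K : fieldType) (T : finType) (S : seq {set T}) p
    (v : 'rV_(size S)) :
  leaf_parent p -> v *m facet_gens K S = 0 ->
  exists w, v = w *m leaf_relations K p.
Proof.
move=> hp; suff gen k (u : 'rV_(size S)) : (k <= size S)%N ->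
    (forall l : 'I_(size S), (k <= l)%N -> u 0 l = 0) ->
    u *m facet_gens K S = 0 -> exists w, u = w *m leaf_relations K p.
  by apply: (gen (size S)) => // l; rewrite leqNgt ltn_ord.
elim: k u => [|k IHk] {}v kS hv ev.
  exists 0; rewrite mul0mx; apply/matrixP=> i l; rewrite ord1 mxE; exact: hv.
case: k => [|k] in IHk kS hv *.
  apply: IHk => // l _; case: (posnP l) => [l0|]; last exact: hv.
  move/(congr1 (fun M : 'M_1 => M 0 0)): ev.
  rewrite mul_facet_gens mxE (bigD1 l) //= big1 => [/eqP|i il].
    by rewrite addr0 mulf_eq0 (negbTE (setmon_neq0 _ _)) orbF => /eqP.
  rewrite hv ?mul0r // lt0n; apply: contraNneq il => i0.
  by rewrite -val_eqE /= i0 l0.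
have km : (k < (size S).-1)%N by rewrite ltn_predRL.
pose m := Ordinal km.
have [|c ec] := leading_coefficient (m := m) hp _ ev.
  by move=> l; apply: hv.
have [||//|w ew] := IHk (v - c *: row m (leaf_relations K p)).
- exact: ltnW.
- move=> l kl; have [pm _] := hp m; have := kl.
  rewrite leq_eqVlt => /predU1P[el|ltl].
    have -> : l = next_ord m by apply: val_inj.
    rewrite !mxE eqxx mulr1n ec.
    have /negbTE-> : next_ord m != p m by rewrite -val_eqE gtn_eqF.
    by rewrite mulr0n subr0 subrr.
  rewrite !mxE (hv l ltl).
  have /negbTE-> : l != next_ord m by rewrite -val_eqE gtn_eqF.
  have /negbTE-> : l != p m by rewrite -val_eqE gtn_eqF // (ltn_trans pm).
  by rewrite mulr0n subrr mulr0 subr0.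
- by rewrite mulmxBl ev -scalemxAl -row_mul leaf_relations_gens row0 scaler0 subr0.
exists (w + c *: delta_mx 0 m).
by rewrite mulmxDl -ew -scalemxAl -rowE subrK.
Qed.

(** The relations form a triangular matrix: a later relation involves the facet
    [next_ord m] only as a parent. *)
Lemma leaf_relations_free (K : fieldType) (T : finType) (S : seq {set T}) p
    (v : 'rV_(size S).-1) :
  leaf_parent p -> v *m leaf_relations K p = 0 -> v = 0.
Proof.
move=> hp ev; suff hv k (m : 'I_(size S).-1) : (size S - m < k)%N -> v 0 m = 0.
  by apply/matrixP=> i m; rewrite ord1 mxE; apply: hv (ltnSn _).
elim: k m => // k IHk m mk.
have := congr1 (fun M : 'rV_(size S) => M 0 (next_ord m)) ev.
rewrite !mxE (bigD1 m) //= big1 => [|j jm]; last first.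
  rewrite !mxE.
  have /negbTE-> : next_ord m != next_ord j.
    by apply: contraNneq jm => /(congr1 val) [] /val_inj->.
  case: eqP => [ej|_]; last by rewrite mulr0n subrr mulr0.
  rewrite IHk ?mul0r //; have [+ _] := hp j; rewrite -ej /=.
  by have := ltn_ord j; lia.
have [pm _] := hp m.
have /negbTE ne : next_ord m != p m by rewrite -val_eqE gtn_eqF.
rewrite !mxE eqxx ne addr0 mulr1n mulr0n subr0 => /eqP.
by rewrite mulf_eq0 (negbTE (setmon_neq0 _ _)) orbF => /eqP.
Qed.

Lemma cardsDz (T : finType) (A B : {set T}) :
  #|A :\: B|%:Z = #|A|%:Z - #|A :&: B|%:Z.
Proof. by rewrite -[in RHS](cardsID B A) PoszD addrAC subrr add0r. Qed.

Lemma cardsCz (T : finType) (A : {set T}) : #|~: A|%:Z = #|T|%:Z - #|A|%:Z.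
Proof. by rewrite -(cardsC A) PoszD addrAC subrr add0r. Qed.

Lemma leaf_resolution_graded (K : fieldType) (T : finType) (S : seq {set T}) p :
  leaf_parent p -> graded_maps (leaf_resolution K (S := S) p).
Proof.
move=> hp; split=> [k|[|[|i]]] /=.
- by rewrite mxE dhomog1.
- by move=> k l; rewrite mxE subr0 -cardsCz; apply: setmon_zhomog.
- move=> m l; rewrite mxE (separatorE _ hp).
  apply: zhomogD; last apply: zhomogN.
    case: eqP => [->|_]; last by rewrite mulr0n zhomog0.
    rewrite mulr1n; set z := (X in zhomog X).
    suff -> : z = #|nth set0 S (next_ord m) :\: nth set0 S (p m)|%:Z.
      exact: setmon_zhomog.
    by rewrite /z cardsDz; ring.
  case: eqP => [->|_]; last by rewrite mulr0n zhomog0.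
  rewrite mulr1n; set z := (X in zhomog X).
  suff -> : z = #|nth set0 S (p m) :\: nth set0 S (next_ord m)|%:Z.
    exact: setmon_zhomog.
  by rewrite /z cardsDz setIC; ring.
- by move=> k l; rewrite mxE; case: (0 - _) => d; rewrite /= ?rpred0 ?eqxx.
Qed.

(** The nonfaces of the Alexander dual are the complements of faces, and every
    face lies in a facet. *)
Lemma dual_ideal_gens (K : fieldType) (T : finType) (Sigma : {set {set T}})
    (S : seq {set T}) (a : {mpoly K[#|T|]}) :
  S =i facets Sigma ->
  sr_ideal (alexander_dual Sigma) a <->
  exists w : 'rV_(size S), a = (w *m facet_gens K S) 0 0.
Proof.
move=> memS; have [I0 ID IM _] := @sr_ideal_homogeneous K T (alexander_dual Sigma).
split; last first.
  case=> w ->; rewrite mul_facet_gens; elim/big_ind: _ => // m _; apply: IM.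
  set B := ~: _; have hB : B \notin alexander_dual Sigma.
    rewrite inE negbK setCK; have := mem_nth set0 (ltn_ord m).
    by rewrite memS inE => /maxsetP[].
  exists (fun A => (A == B)%:R); rewrite (bigD1 B) //= eqxx mul1r big1 ?addr0 //.
  by move=> A /andP[_ /negbTE->]; rewrite mul0r.
case=> c ->; elim/big_ind: _ => [|a1 a2 [w1 ->] [w2 ->]|A].
- by exists 0; rewrite mul0mx mxE.
- by exists (w1 + w2); rewrite mulmxDl [RHS]mxE.
rewrite inE negbK => /face_in_facet[B]; rewrite -memS => /(nthP set0)[i iS <-] sub.
exists (c A * setmon K (A :\: ~: nth set0 S i) *: delta_mx 0 (Ordinal iS)).
rewrite -scalemxAl -rowE !mxE /= -mulrA -setmonD //.
by rewrite -setCS setCK.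
Qed.

Lemma leaf_resolution_minimal (K : fieldType) (T : finType)
    (Sigma : {set {set T}}) (S : seq {set T}) p :
  leaf_order Sigma S -> (2 <= size S)%N -> leaf_parent p ->
  minimal_resolution (sr_ideal (alexander_dual Sigma))
    (leaf_resolution K (S := S) p).
Proof.
move=> hS S2 hp; have [uS memS _] := hS.
have aug1 (v : 'rV_1) : (v *m (const_mx 1 : 'cV[{mpoly K[#|T|]}]_1)) 0 0 = v 0 0.
  by rewrite mxE big_ord1 mxE mulr1.
split; last first.
  case=> [|[|i]] k l /=; last by rewrite mxE mcoeff0.
    rewrite mxE setmon_const0 //.
    have [j jk] : exists j : 'I_(size S), j != k.
      case: (posnP k) => [k0|k_gt0].
        by exists (Ordinal S2); rewrite -val_eqE /= k0.
      by exists (Ordinal (ltnW S2)); rewrite -val_eqE eq_sym -lt0n.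
    apply: contraNneq (facet_diff_neq0 hS jk) => e.
    by rewrite setDE e setI0.
  have [pm _] := hp k.
  have ne : next_ord k != p k by rewrite -val_eqE gtn_eqF.
  rewrite mxE mcoeffB !mcoeffMn !setmon_const0 ?mul0rn ?subr0 //.
    by apply: facet_diff_neq0 hS _; rewrite eq_sym.
  exact: facet_diff_neq0 hS ne.
split.
- exact: leaf_resolution_graded.
- exists (const_mx 1); rewrite aug1 mxE subrr.
  by have [] := @sr_ideal_homogeneous K T (alexander_dual Sigma).
- move=> v; rewrite aug1 (dual_ideal_gens _ memS).
  split=> [[w ew]|[w ->]]; exists w => //.
  by apply/matrixP=> i j; rewrite !ord1.
case=> [|[|i]] v /=; (split; last case=> w ->).
- exact: leaf_relations_generate.
- by rewrite -mulmxA leaf_relations_gens mulmx0.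
- by move/(leaf_relations_free hp)->; exists 0; rewrite mul0mx.
- by rewrite [w]thinmx0 !mul0mx.
- by move=> _; exists 0; rewrite mul0mx; apply: thinmx0.
- by rewrite !mulmx0.
Qed.

(** * Numerical invariants *)

Lemma facet_card_lt (T : finType) (Sigma : {set {set T}}) (S : seq {set T})
    (l : 'I_(size S)) :
  leaf_order Sigma S -> (2 <= size S)%N -> (#|nth set0 S l| < #|T|)%N.
Proof.
move=> hS S2; have [j jl] : exists j : 'I_(size S), j != l.
  case: (posnP l) => [l0|l_gt0].
    by exists (Ordinal S2); rewrite -val_eqE /= l0.
  by exists (Ordinal (ltnW S2)); rewrite -val_eqE eq_sym -lt0n.
rewrite -cardsT; apply: proper_card; rewrite properT.
by apply: contraNneq (facet_diff_neq0 hS jl) => ->; rewrite setDT.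
Qed.

Lemma rmin_le (T : finType) (S : seq {set T}) (m : 'I_(size S).-1) :
  (rmin S <= #|separator S m|)%N.
Proof. by rewrite /rmin -leEnat -minEnat; apply: bigmin_le. Qed.

Lemma rmin_attained (T : finType) (S : seq {set T}) :
  (2 <= size S)%N -> exists m : 'I_(size S).-1, rmin S = #|separator S m|.
Proof.
move=> S2; have m0 : 'I_(size S).-1 by apply: Ordinal (_ : 0 < _)%N; lia.
rewrite /rmin -minEnat.
have [|m _ ->] := @eq_bigmin _ _ _ #|T| m0 predT
  (fun m : 'I_(size S).-1 => #|separator S m|) isT.
  by move=> m _; rewrite leEnat max_card.
by exists m.
Qed.

Lemma rmin_lt_facet (T : finType) (Sigma : {set {set T}}) (S : seq {set T})
    (l : 'I_(size S)) :
  leaf_order Sigma S -> (2 <= size S)%N -> (rmin S < #|nth set0 S l|)%N.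
Proof.
move=> hS S2; have [p hp] := leaf_parent_exists hS.
have sub_lt (A B : {set T}) : A :\: B != set0 -> (#|A :&: B| < #|A|)%N.
  by rewrite -cards_eq0 -(cardsID B A) -lt0n; lia.
(* The first facet contains the first separator, and each later facet the one
   along which it is attached. *)
case: (posnP l) => [l0|l_gt0]; last first.
  have hm : (l.-1 < (size S).-1)%N by have := ltn_ord l; lia.
  pose m := Ordinal hm.
  have el : l = next_ord m by apply: val_inj; rewrite /= prednK.
  apply: leq_ltn_trans (rmin_le m) _; rewrite (separatorE _ hp) el.
  have [pm _] := hp m.
  by apply: sub_lt; apply: facet_diff_neq0 hS _; rewrite -val_eqE gtn_eqF.
have hm : (0 < (size S).-1)%N by lia.
pose m := Ordinal hm; have [pm _] := hp m.
have el : l = p m by apply: val_inj; move: pm => /=; lia.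
apply: leq_ltn_trans (rmin_le m) _; rewrite (separatorE _ hp) el setIC.
by apply: sub_lt; apply: facet_diff_neq0 hS _; rewrite -val_eqE ltn_eqF.
Qed.

(** A smallest non-clique is a pair of non-adjacent vertices. *)
Lemma sr_dim_dual_clique (T : finType) (e : rel T) (S : seq {set T}) :
  leaf_order (clique_complex e) S -> (2 <= size S)%N ->
  sr_dim (alexander_dual (clique_complex e)) = (#|T| - 2)%N.
Proof.
move=> hS S2; have [_ memS _] := hS.
have nonclique (A : {set T}) : ~~ clique e A ->
    exists x y, [/\ x \in A, y \in A, x != y & ~~ e x y].
  move/forall_inPn=> [x xA] /forall_inPn[y yA].
  by rewrite negb_imply => /andP[xy exy]; exists x, y.
have [x [y [_ _ xy exy]]] : exists x y,
    [/\ x \in [set: T], y \in [set: T], x != y & ~~ e x y].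
  apply/nonclique/negP => cT.
  have /face_in_facet[B] : [set: T] \in clique_complex e by rewrite inE.
  rewrite -memS => /(nthP set0)[i iS <-] /subset_leq_card; rewrite cardsT.
  by rewrite leqNgt (facet_card_lt (Ordinal iS) hS S2).
apply/eqP; rewrite eqn_leq; apply/andP; split.
  apply/bigmax_leqP => A; rewrite !inE => /nonclique[u [v [uA vA uv _]]].
  have : (#|[set u; v]| <= #|~: A|)%N.
    apply: subset_leq_card; apply/subsetP => z.
    by rewrite !inE => /orP[]/eqP->; rewrite -in_setC.
  by rewrite cards2 uv -(cardsC A); lia.
have <- : #|~: [set x; y]| = (#|T| - 2)%N.
  by rewrite -(cardsC [set x; y]) cards2 xy addKn.
rewrite /sr_dim; apply: (@bigop.leq_bigmax_cond _
  (mem (alexander_dual (clique_complex e))) (fun A : {set T} => #|A|)).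
rewrite !inE setCK; apply: contra exy.
move=> /forall_inP/(_ x); rewrite !inE eqxx => /(_ isT)/forall_inP/(_ y).
by rewrite !inE eqxx orbT xy => /(_ isT).
Qed.

Lemma betti_gdeg (K : fieldType) (n : nat) (F : graded_complex K n) i
    (k : 'I_(grank F i)) : betti F i (gdeg k) <> 0%N.
Proof. by apply/eqP; rewrite cards_eq0; apply/set0Pn; exists k; rewrite inE. Qed.

Lemma card_set_neq0 (J : finType) (A : eqType) (f : J -> A) (a : A) :
  #|[set m | f m == a]| <> 0%N -> exists m, f m = a.
Proof.
by move=> /eqP; rewrite cards_eq0 => /set0Pn[m]; rewrite inE => /eqP; exists m.
Qed.

Theorem corollary9 (K : fieldType) (T : finType) (e : rel T)
    (S : seq {set T})
    (e_sym : ssrbool.symmetric e) (e_irr : ssrbool.irreflexive e) (e_chordal : chordal e)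
    (S_leaf : leaf_order (clique_complex e) S) (S_ge2 : (2 <= size S)%N) :
  let dual := alexander_dual (clique_complex e) in
  (exists F : graded_complex K #|T|, minimal_resolution (sr_ideal dual) F) /\
  forall F : graded_complex K #|T|, minimal_resolution (sr_ideal dual) F ->
    (forall j : int,
       [/\ betti F 0 j = (j == 0),
           betti F 1 j = #|[set m : 'I_(size S) |
                              #|T|%:Z - #|nth set0 S m|%:Z == j]|,
           betti F 2 j = #|[set m : 'I_(size S).-1 |
                              #|T|%:Z - #|separator S m|%:Z == j]|
         & forall i, (3 <= i)%N -> betti F i j = 0%N]) /\
    [/\ is_reg F (#|T|%:Z - (rmin S)%:Z - 2),
        is_type F (size S).-1
      & is_a_invariant F (sr_dim dual) (- (rmin S)%:Z)].
Proof.
move=> dual; have [p hp] := leaf_parent_exists S_leaf.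
have hG := leaf_resolution_minimal K S_leaf S_ge2 hp.
split; first by exists (leaf_resolution K p).
move=> F hF; have hI := @sr_ideal_homogeneous K T dual.
have eq_betti i j : betti F i j = betti (leaf_resolution K p) i j.
  apply/eqP; rewrite eqn_leq (minimal_betti_le i j hI hF hG.1).
  exact: minimal_betti_le i j hI hG hF.1.
have eq_rank i : grank F i = leaf_rank S i.
  apply/eqP; rewrite eqn_leq (minimal_rank_le i hI hF hG.1).
  exact: (minimal_rank_le i hI hG hF.1).
have bettiF j : [/\ betti F 0 j = (j == 0),
    betti F 1 j = #|[set m : 'I_(size S) | #|T|%:Z - #|nth set0 S m|%:Z == j]|,
    betti F 2 j = #|[set m : 'I_(size S).-1 | #|T|%:Z - #|separator S m|%:Z == j]|
  & forall i, (3 <= i)%N -> betti F i j = 0%N].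
  split=> [|||[|[|[|i]]] // _]; rewrite eq_betti //.
    rewrite /betti /= eq_sym; case: eqP => _; last first.
      by apply: eq_card0 => k; rewrite inE.
    by rewrite -[RHS](card_ord 1); apply: eq_card => k; rewrite inE.
  by apply: eq_card0 => -[].
split=> //.
have [m0 em0] := rmin_attained S_ge2.
have betti_rmin : betti F 2 (#|T|%:Z - (rmin S)%:Z) <> 0%N.
  have [_ _ -> _] := bettiF (#|T|%:Z - (rmin S)%:Z).
  by apply/eqP; rewrite cards_eq0; apply/set0Pn; exists m0; rewrite inE em0.
have degF2 (k : 'I_(grank F 2)) : gdeg k <= #|T|%:Z - (rmin S)%:Z.
  have [_ _ e2 _] := bettiF (gdeg k); have := betti_gdeg (k := k).
  by rewrite e2 => /card_set_neq0[m <-]; have := rmin_le m; lia.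
split.
- split.
    by exists 2%N, (#|T|%:Z - (rmin S)%:Z); split.
  move=> i j; have [e0 e1 e2 e3] := bettiF j.
  pose l := next_ord m0.
  have r_l := rmin_lt_facet l S_leaf S_ge2; have l_T := facet_card_lt l S_leaf S_ge2.
  case: i => [|[|[|i]]]; rewrite ?e0 ?e1 ?e2 ?e3 //.
  + by case: eqP => // -> _; lia.
  + by move=> /card_set_neq0[m <-]; have := rmin_lt_facet m S_leaf S_ge2; lia.
  + by move=> /card_set_neq0[m <-]; have := rmin_le m; lia.
- exists 2%N; rewrite !eq_rank; split=> //=; first by lia.
  by move=> [|[|[|q]]] // _; rewrite eq_rank.
have lT := facet_card_lt (next_ord m0) S_leaf S_ge2.
have rl := rmin_lt_facet (next_ord m0) S_leaf S_ge2.
rewrite /is_a_invariant (sr_dim_dual_clique S_leaf S_ge2) subKn; last by lia.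
rewrite opprK; split.
  have [k ek] := card_set_neq0 betti_rmin.
  (* The dual basis vector of a generator of largest degree is not a
     coboundary: by minimality the entries of a coboundary have no constant
     coefficient. *)
  exists (delta_mx k 0); split.
  + move=> l; rewrite mxE eqxx andbT; case: eqP => [->|_]; last exact: zhomog0.
    by rewrite ek (_ : _ - _ = 0) /= ?dhomog1 //; lia.
  + by apply/matrixP=> i; have := ltn_ord i; rewrite [X in (_ < X)%N]eq_rank.
  case=> w /(congr1 (fun M : 'cV_(grank F 2) => (M k 0)@_0%MM)).
  rewrite (mulmx_const0 (or_introl _ (hF.2 1%N))) mxE !eqxx mcoeff1 eqxx.
  exact/eqP/oner_neq0.
move=> t [u [hu _ ncob]].
have [k uk] : exists k, u k 0 != 0.
  apply/existsP; apply: contra_notT ncob => /existsPn u0; exists 0.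
  rewrite mulmx0; apply/matrixP=> k j; rewrite ord1 mxE; apply/eqP.
  by have := u0 k; rewrite negbK.
by have := zhomog_ge0 (hu k) uk; have := degF2 k; lia.
Qed.
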